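(* Let $C_n$ be a cycle on $n$ vertices. Let $m$ be the largest integer such that $m^2\le n$, and write $n=m^2+r$. Then $$\operatorname{th}(C_n)=\begin{cases}2m-1 & \text{if } r=0 \text{ and } m \text{ is even},\\ 2m & \text{if } 0<r\le m, \text{ or } (r=0 \text{ and } m \text{ is odd}),\\ 2m+1 & \text{if } m<r<2m+1.\end{cases}$$
   Context: All graphs are finite, simple and undirected (so $n\ge 3$ for a cycle $C_n$). Standard color change rule: each vertex of $G$ is blue or white; a white vertex $w$ is colored blue (forced by the blue vertex $v$) when $w$ is the only white neighbor of $v$. Starting with exactly the vertices of $S\subseteq V(G)$ blue, at each time step all possible forces are performed simultaneously. $S$ is a standard zero forcing set if eventually all vertices become blue; in that case $\operatorname{pt}(G,S)$ is the number of time steps needed to color all vertices blue (so it is $0$ if $S=V(G)$), and otherwise $\operatorname{pt}(G,S)=\infty$. Define $\operatorname{th}(G,S)=|S|+\operatorname{pt}(G,S)$, and the (standard) throttling number $\operatorname{th}(G)=\min\{\operatorname{th}(G,S): S\text{ is a standard zero forcing set of }G\}$. *)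

(* Defs.v *)
From mathcomp Require Import all_boot.

Set Implicit Arguments.
Unset Strict Implicit.
Unset Printing Implicit Defensive.

Record sgraph := SGraph {
  vertex :> finType;
  adj : rel vertex;
  adj_sym : symmetric adj;
  adj_irrefl : irreflexive adj
}.
Arguments adj {s} _ _.

Section ZeroForcing.
Variable G : sgraph.
Implicit Types (S B : {set G}) (v w : G).

(* Under the standard rule, with B the current set of blue vertices, v forces w. *)
Definition forces B v w : bool :=
  [&& v \in B, w \notin B, adj v w &
      [forall u : G, (adj v u && (u \notin B)) ==> (u == w)]].

Definition step B : {set G} := B :|: [set w | [exists v, forces B v w]].

Definition blue S (t : nat) : {set G} := iter t step S.

Definition zero_forcing S : Prop := exists t : nat, blue S t == [set: G].

Lemma blue_leq_card S t : blue S t == [set: G] ->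
  exists2 k, k <= #|G| & blue S k == [set: G].
Proof.
move=> Ht; have exP : exists t, blue S t == [set: G] by exists t.
case: (ex_minnP exP) => k Hk kmin; exists k => //.
have stab i : blue S i.+1 = blue S i -> forall j, blue S (j + i) = blue S i.
  move=> Hi; elim=> [//|j IHj]; rewrite addSn /blue iterS.
  by move: IHj Hi; rewrite /blue => ->.
suff H j : j <= k -> j <= #|blue S j|.
  exact: leq_trans (H k (leqnn k)) (max_card _).
elim: j => [//|j IHj] ltjk; apply: leq_ltn_trans (IHj (ltnW ltjk)) _.
apply/proper_card; rewrite properEneq subsetUl andbT.
apply/eqP => Hj; have := stab j (esym Hj) (k - j).
rewrite subnK 1?ltnW // => Hjk; have := kmin j.
by rewrite -Hjk Hk leqNgt ltjk => /(_ isT).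
Qed.

Lemma zero_forcing_dec S : decidable (zero_forcing S).
Proof.
apply: (@decP _ [exists t : 'I_#|G|.+1, blue S t == [set: G]]).
apply: (iffP existsP) => [[t Ht]|[t /blue_leq_card[k lek Hk]]]; first by exists t.
by exists (Ordinal (lek : k < #|G|.+1)).
Qed.

(* None stands for an infinite propagation time. *)
Definition pt S : option nat :=
  if zero_forcing_dec S is left zfS then Some (ex_minn zfS) else None.

Definition th_set S : option nat := omap (addn #|S|) (pt S).

Lemma ex_th_set : exists k : nat, [exists S : {set G}, th_set S == Some k].
Proof.
have zfT : zero_forcing [set: G] by exists 0.
exists (#|G| + odflt 0 (pt [set: G])); apply/existsP; exists [set: G].
by rewrite /th_set /pt; case: zero_forcing_dec => //= ?; rewrite cardsT.
Qed.

(* The minimum over zero forcing sets: exactly those have th_set S <> None. *)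
Definition th : nat := ex_minn ex_th_set.

End ZeroForcing.

(* ordS i is i + 1 modulo n. *)
Definition cycle_adj (n : nat) : rel 'I_n :=
  fun i j => (j == ordS i) || (i == ordS j).

Lemma cycle_adj_sym n : symmetric (@cycle_adj n).
Proof. by move=> i j; rewrite /cycle_adj orbC. Qed.

Lemma cycle_adj_irrefl n : 2 < n -> irreflexive (@cycle_adj n).
Proof.
move=> n3 i; rewrite /cycle_adj orbb; apply/negbTE/eqP => /(congr1 val) /=.
have := ltn_ord i; rewrite leq_eqVlt => /orP[/eqP iE|ltin].
  by rewrite iE modnn => i0; move: n3; rewrite -iE i0.
by rewrite modn_small // => /eqP; rewrite ltn_eqF.
Qed.

Definition cycle_graph (n : nat) (n3 : 2 < n) : sgraph :=
  SGraph (@cycle_adj_sym n) (cycle_adj_irrefl n3).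

(* Main.v *)
Require Import Defs.
From mathcomp Require Import all_boot zify.

Set Implicit Arguments.
Unset Strict Implicit.
Unset Printing Implicit Defensive.

(** Write [s] for the size of a forcing set and [t] for its propagation time.

    Lower bound.  A blue vertex can still force only while it has a white
    neighbor; call it active.  In one step every new blue vertex has its own
    forcer, which was active and is active no more, so the number of active
    vertices never grows ([card_active_step]).  Hence each step adds at most
    [s] vertices and [#|G| <= s * (t + 1)] ([card_sgraph_le]).  If [t > 0] and
    equality holds, then every vertex of [S] forces in the first step
    ([card_sgraph_lt]); on a cycle this means that every vertex of [S] has
    exactly one neighbor in [S], so [S] is perfectly matched by its own edges
    and [s] is even ([even_card_forcing]).

    Upper bound.  Two adjacent blue vertices spread in both directions and fill
    a window of [2 * (t + 1)] vertices in [t] steps.  So if [p] windows cover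
    the cycle, that is if [n <= 2 * p * (t + 1)], then [p] pairs suffice and
    [th <= 2 * p + t] ([th_cycle_le]).

    Thus [th] is the minimum of [s + t] subject to [n <= s * (t + 1)], up to
    parity.  By the inequality between arithmetic and geometric means,
    [s + (t + 1) <= 2 * m] gives a product of at most [m ^ 2], and
    [s + (t + 1) <= 2 * m + 1] one of at most [m * (m + 1)]; this yields the
    three values.  They are reached with [s] the even one of [m] and [m + 1],
    for which a factor [t + 1] among [m], [m + 1], [m + 2] is available, except
    when [n = m ^ 2] with [m] odd: there the sum [2 * m] would force
    [s = t + 1 = m], which parity excludes. *)

(** * Throttling in arbitrary graphs *)

Section Throttling.
Variable G : sgraph.
Implicit Types (S B : {set G}) (v w : G).

Lemma th_le S t : blue S t = [set: G] -> th G <= #|S| + t.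
Proof.
move=> /eqP St; rewrite /th; case: ex_minnP => k _ kmin.
have zfS : zero_forcing S by exists t.
apply: leq_trans (kmin (#|S| + odflt 0 (pt S)) _) _.
  by apply/existsP; exists S; rewrite /th_set /pt; case: zero_forcing_dec.
rewrite leq_add2l /pt; case: zero_forcing_dec => //= zf.
by case: ex_minnP => j _; apply.
Qed.

Lemma th_attained :
  exists S t, blue S t = [set: G] /\ th G = #|S| + t.
Proof.
rewrite /th; case: ex_minnP => k /existsP[S /eqP Sk] _; exists S.
move: Sk; rewrite /th_set /pt; case: zero_forcing_dec => //= zfS [<-].
by case: ex_minnP => j /eqP Sj _; exists j.
Qed.

Definition active B : {set G} :=
  [set v in B | [exists u, adj v u && (u \notin B)]].

Definition forcer B w : G := odflt w [pick v | forces B v w].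

Lemma forcerP B w : w \in step B :\: B -> forces B (forcer B w) w.
Proof.
rewrite !inE /forcer => /andP[/negbTE-> /existsP[v vw]].
by case: pickP => // /(_ v); rewrite vw.
Qed.

Lemma forces_uniq B v w u : forces B v w -> adj v u -> u \notin B -> u = w.
Proof.
by case/and4P=> _ _ _ /forallP/(_ u)/implyP vB vu uB; apply/eqP/vB/andP.
Qed.

Lemma forces_step B v w : forces B v w -> w \in step B.
Proof. by move=> vw; rewrite !inE; apply/orP; right; apply/existsP; exists v. Qed.

Lemma mem_step B v w : v \in B -> adj v w ->
  (forall u, adj v u -> u \in B \/ u = w) -> w \in step B.
Proof.
move=> vB vw vF; have [wB|wB] := boolP (w \in B).
  by rewrite in_setU wB.
apply: (@forces_step _ v); rewrite /forces vB wB vw.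
by apply/forallP => u; apply/implyP => /andP[/vF[->//|->]]; rewrite eqxx.
Qed.

Lemma forcer_inj B : {in step B :\: B &, injective (forcer B)}.
Proof.
move=> w1 w2 /forcerP F1 /forcerP F2 eqF; rewrite -eqF in F2.
case/and4P: (F1) => _ w1B vw1 _; exact: forces_uniq F2 vw1 w1B.
Qed.

Lemma sub_step B : B \subset step B.
Proof. exact: subsetUl. Qed.

Lemma card_step B : #|step B| = #|B| + #|step B :\: B|.
Proof. by rewrite -(cardsID B (step B)) (setIidPr (sub_step B)). Qed.

(** Once a vertex has forced, all its neighbors are blue. *)
Lemma forcer_active B :
  forcer B @: (step B :\: B) \subset active B :\: active (step B).
Proof.
apply/subsetP => v /imsetP[w wN ->]; have F := forcerP wN.
case/and4P: (F) => vB wB vw _; rewrite !in_set vB.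
apply/andP; split; last by apply/existsP; exists w; rewrite vw.
rewrite negb_and; apply/orP; right; apply/existsPn => u.
rewrite negb_and negbK; have [vu /=|//] := boolP (adj _ u).
have [uB|uB] := boolP (u \in B); first by apply: (subsetP (sub_step B)).
by rewrite (forces_uniq F vu uB); exact: forces_step F.
Qed.

Lemma card_new_le B : #|step B :\: B| <= #|active B :\: active (step B)|.
Proof.
by rewrite -(card_in_imset (@forcer_inj B)); apply/subset_leq_card/forcer_active.
Qed.

(** An active vertex of [step B] is either new, and then paid for by its forcer,
    or it was active before. *)
Lemma card_active_step B : #|active (step B)| <= #|active B|.
Proof.
have sub : active (step B) \subset
    (active B :&: active (step B)) :|: (step B :\: B).
  apply/subsetP => v vA; rewrite !in_setU in_setI in_setD vA.
  move: (vA); rewrite in_set => /andP[-> /existsP[u /andP[vu uB]]].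
  have [vB|vB] := boolP (v \in B); last by rewrite /= orbT.
  rewrite !in_set vB /= andbT orbF.
  apply/existsP; exists u; rewrite vu /=.
  by apply: contra uB; apply: (subsetP (sub_step B)).
apply: leq_trans (subset_leq_card sub) _.
apply: leq_trans (leq_card_setU _ _) _.
by rewrite -(cardsID (active (step B)) (active B)) leq_add2l card_new_le.
Qed.

Lemma card_active_le S t : #|active (blue S t)| <= #|S|.
Proof.
elim: t => [|t IH]; last exact: leq_trans (card_active_step _) IH.
by apply/subset_leq_card/subsetP => v; rewrite in_set => /andP[].
Qed.

Lemma card_blueS S t : #|blue S t.+1| <= #|blue S t| + #|S|.
Proof.
rewrite /blue iterS card_step leq_add2l.
apply: leq_trans (card_new_le _) _.
exact: leq_trans (subset_leq_card (subsetDl _ _)) (card_active_le S t).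
Qed.

Lemma card_blue_le S i t : #|blue S (t + i)| <= #|blue S i| + #|S| * t.
Proof.
elim: t => [|t IH]; first by rewrite muln0 addn0.
apply: leq_trans (card_blueS _ _) _; rewrite mulnS [#|S| + _]addnC addnA.
by rewrite leq_add2r.
Qed.

Lemma card_sgraph_le S t : blue S t = [set: G] -> #|G| <= #|S| * t.+1.
Proof.
by move=> St; rewrite -cardsT -St mulnS; have := card_blue_le S 0 t; rewrite addn0.
Qed.

(** A vertex of [S] that does not force at once makes the first step gain less
    than [#|S|], a loss that no later step can make up for. *)
Lemma card_sgraph_lt S t : blue S t.+1 = [set: G] ->
  ~ (forall v, v \in S -> exists w, forces S v w) -> #|G| < #|S| * t.+2.
Proof.
move=> St nF; rewrite -cardsT -St -[in blue S _]addn1.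
have := card_blue_le S 1 t; rewrite {2}/blue /= card_step => le.
suff lt : #|step S :\: S| < #|S| by lia.
rewrite -(card_in_imset (@forcer_inj S)) ltnNge; apply/negP => leS.
have subS : forcer S @: (step S :\: S) \subset S.
  by apply/subsetP => v /imsetP[w /forcerP/and4P[]] ? _ _ _ ->.
have eqS : forcer S @: (step S :\: S) = S by apply/eqP; rewrite eqEcard subS.
apply: nF => v; rewrite -{1}eqS => /imsetP[w wN ->]; exists w.
exact: forcerP.
Qed.

End Throttling.

(** * Cycles *)

Section Cycle.
Variables (n : nat) (n3 : 2 < n).
Let C := cycle_graph n3.
Implicit Types (S B : {set C}).

Lemma n_gt0 : 0 < n. Proof. exact: ltnW (ltnW n3). Qed.

(** The vertex at position [k] on the universal cover of the cycle; walking
    along it avoids all case distinctions at the end of ['I_n]. *)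
Definition vtx (k : nat) : C := Ordinal (ltn_pmod k n_gt0).

Lemma vtx_ord (i : 'I_n) : vtx i = i.
Proof. by apply: val_inj; rewrite /= modn_small. Qed.

Lemma ordS_vtx k : ordS (vtx k) = vtx k.+1.
Proof. by apply: val_inj; rewrite /= -addn1 modnDml addn1. Qed.

Lemma adj_vtx k : adj (vtx k) (vtx k.+1).
Proof. by rewrite /= /cycle_adj ordS_vtx eqxx. Qed.

Lemma adj_vtxS k (u : C) : adj (vtx k.+1) u -> u = vtx k \/ u = vtx k.+2.
Proof.
rewrite /= /cycle_adj ordS_vtx => /orP[/eqP->|]; first by right.
by rewrite -ordS_vtx (inj_eq (@ordS_inj n)) => /eqP <-; left.
Qed.

Lemma vtx_neq2 k : vtx k != vtx k.+2.
Proof.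
apply/negP => /eqP/(congr1 val)/= /eqP.
by rewrite -[k in k %% n]addn0 -addn2 eqn_modDl mod0n modn_small.
Qed.

Lemma step_right B k :
  vtx k \in B -> vtx k.+1 \in B -> vtx k.+2 \in step B.
Proof.
move=> kB k1B; apply: mem_step k1B (adj_vtx _) _ => u.
by case/adj_vtxS => ->; [left | right].
Qed.

Lemma step_left B k :
  vtx k.+1 \in B -> vtx k.+2 \in B -> vtx k \in step B.
Proof.
move=> k1B k2B; apply: mem_step k1B _ _.
  by rewrite adj_sym; exact: adj_vtx.
by move=> u; case/adj_vtxS => ->; [right | left].
Qed.

Lemma blue_right S k t : vtx k \in S -> vtx k.+1 \in S ->
  forall j, j <= t.+1 -> vtx (k + j) \in blue S t.
Proof.
move=> kS k1S; elim: t => [|t IH] j.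
  by case: j => [|[|]] // _; rewrite ?addn0 ?addn1.
rewrite leq_eqVlt => /orP[/eqP->|/IH jB].
  by rewrite !addnS; apply: step_right; rewrite -?addnS; apply: IH.
exact: (subsetP (sub_step _)).
Qed.

Lemma blue_left S k t : vtx (k + t) \in S -> vtx (k + t).+1 \in S ->
  forall j, j <= t.+1 -> vtx (k + j) \in blue S t.
Proof.
elim: t k => [|t IH] k kS k1S j.
  by rewrite addn0 in kS k1S; case: j => [|[|]] // _; rewrite ?addn0 ?addn1.
rewrite -addSnnS in kS k1S; have {IH} kB := IH _ kS k1S.
case: j => [_|j].
  rewrite addn0; apply: step_left; first by have := kB 0; rewrite addn0; apply.
  by have := kB 1; rewrite addn1; apply.
by rewrite -addSnnS ltnS => jt; apply: (subsetP (sub_step _)); exact: kB.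
Qed.

Lemma blue_window S k t : vtx (k + t) \in S -> vtx (k + t).+1 \in S ->
  forall j, j < 2 * t.+1 -> vtx (k + j) \in blue S t.
Proof.
move=> kS k1S j jt; have [le|lt] := leqP j t.+1; first exact: blue_left.
have -> : k + j = k + t + (j - t) by lia.
by apply: blue_right => //; lia.
Qed.

Lemma th_cycle_le p t : n <= 2 * p * t.+1 -> th C <= 2 * p + t.
Proof.
move=> np; set w := 2 * t.+1.
(* The blue pair sits in the middle of each window of length [w]. *)
pose f (jb : 'I_p * bool) : C := vtx (w * jb.1 + t + jb.2).
pose S : {set C} := f @: [set: 'I_p * bool].
have cS : #|S| <= 2 * p.
  apply: leq_trans (leq_imset_card _ _) _.
  by rewrite cardsT card_prod card_ord card_bool mulnC.
have St : blue S t = [set: C].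
  apply/setP => i; rewrite in_setT.
  have wp : i %/ w < p.
    by rewrite ltn_divLR // (leq_trans (ltn_ord i)) // /w mulnA [p * 2]mulnC.
  rewrite -(vtx_ord i) (divn_eq i w) mulnC.
  apply: blue_window; last by rewrite ltn_mod.
    by apply/imsetP; exists (Ordinal wp, false); rewrite // /f addn0.
  by apply/imsetP; exists (Ordinal wp, true); rewrite // /f addn1.
by apply: leq_trans (th_le St) _; rewrite leq_add2r.
Qed.

(** The edges inside [S] match it perfectly: the starting points of these edges
    and their end points split [S] in two halves, exchanged by [ordS]. *)
Lemma even_card_forcing S :
  (forall v, v \in S -> exists w, forces S v w) -> ~~ odd #|S|.
Proof.
move=> SF; pose A := [set v in S | ordS v \in S].
have one k : vtx k.+1 \in S -> (vtx k \in S) = (vtx k.+2 \notin S).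
  move=> kS; case: (SF _ kS) => w F; case/and4P: (F) => _ wS vw _.
  have nb u : adj (vtx k.+1) u -> (u \in S) = (u != w).
    move=> vu; apply/idP/idP => [uS|]; first by apply: contraNneq wS => <-.
    by apply: contraR => uS; apply/eqP; exact: forces_uniq F vu uS.
  rewrite !nb ?adj_vtx 1?adj_sym ?adj_vtx // negbK.
  case/adj_vtxS: vw => ->; rewrite eqxx; last exact: vtx_neq2.
  by rewrite [_ == vtx k]eq_sym (negbTE (vtx_neq2 k)).
have lift v : exists k, v = vtx k.+1.
  exists (v + n.-1); rewrite -addnS prednK ?n_gt0 //.
  by apply: val_inj; rewrite /= modnDr modn_small.
have DA : S :\: A = @ordS n @: A.
  apply/setP => v; have [k ->] := lift v.
  rewrite -{2}ordS_vtx (mem_imset _ _ (@ordS_inj n)) !in_set !ordS_vtx.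
  have [kS|_] := boolP (vtx k.+1 \in S); last by rewrite !andbF.
  by rewrite /= !andbT -one.
rewrite -(cardsID A S) DA card_imset; last exact: ordS_inj.
have /setIidPr -> : A \subset S by apply/subsetP => v; rewrite in_set => /andP[].
by rewrite addnn odd_double.
Qed.

Lemma cycle_bound S t : blue S t = [set: C] -> n <= #|S| * t.+1.
Proof. by move/card_sgraph_le; rewrite card_ord. Qed.

Lemma cycle_bound_odd S t :
  blue S t.+1 = [set: C] -> odd #|S| -> n < #|S| * t.+2.
Proof.
move=> St oS; have := card_sgraph_lt St; rewrite card_ord; apply.
by move/even_card_forcing; rewrite oS.
Qed.

End Cycle.

Theorem theorem7p1 (n : nat) (n3 : 2 < n) (m r : nat)
    (hm : m ^ 2 <= n) (hmax : forall k : nat, k ^ 2 <= n -> k <= m)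
    (hr : n = m ^ 2 + r) :
  [/\ r = 0 /\ ~~ odd m -> th (cycle_graph n3) = 2 * m - 1,
      0 < r <= m \/ (r = 0 /\ odd m) -> th (cycle_graph n3) = 2 * m
    & m < r < 2 * m + 1 -> th (cycle_graph n3) = 2 * m + 1].
Proof.
have [S [t [St thE]]] := th_attained (cycle_graph n3).
have lb := cycle_bound St.
have := nat_AGM2 #|S| t.+1 => /leqifP agm.
have {agm} agm : 4 * (#|S| * t.+1) <= (#|S| + t.+1) ^ 2.
  by move: agm; case: ifP => _; [move/eqP->| move/ltnW].
have ub s u : ~~ odd s -> n <= s * u.+1 -> th (cycle_graph n3) <= s + u.
  by move=> es; rewrite -(even_halfK es) -mul2n; exact: th_cycle_le.
rewrite -!mulnn in hr agm *.
(* Each upper bound takes for [s] the even one of [m] and [m + 1]. *)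
split.
- move=> [r0 em]; apply/eqP; rewrite eqn_leq; apply/andP; split.
    by have := ub m m.-1 em; nia.
  by rewrite thE; nia.
- move=> rP; apply/eqP; rewrite eqn_leq; apply/andP; split.
    have [om|em] := boolP (odd m).
      by have := ub m.+1 m.-1; rewrite /= om => /(_ isT); nia.
    by have := ub m m em; case: rP => [|[_ om]]; [nia | rewrite om in em].
  rewrite thE; case: rP => [rP|[r0 om]]; first by nia.
  rewrite leqNgt; apply/negP => lt.
  (* Equality holds in the mean inequality, so the two factors are equal. *)
  have [Sm tm] : #|S| = m /\ t.+1 = m by split; nia.
  have t0 : 0 < t by nia.
  rewrite -(prednK t0) in St.
  by have := cycle_bound_odd St; rewrite Sm om => /(_ isT); nia.
- move=> rP; apply/eqP; rewrite eqn_leq; apply/andP; split.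
    have [om|em] := boolP (odd m).
      by have := ub m.+1 m; rewrite /= om => /(_ isT); nia.
    by have := ub m m.+1 em; nia.
  by rewrite thE; nia.
Qed.
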